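(* Let $n\ge 1$. A nonempty subset $D\subseteq S_n$ is a $1$-design in $(S_n,d_S)$ if and only if $\sum_{j=0}^n j f_j=n-1$. In particular, if $D$ consists of $n$ permutations that are pairwise at distance $n$ (so that $f_1=\dots=f_{n-1}=0$ and $f_n=\frac{n-1}{n}$), then $D$ is a $1$-design.
   Context: $S_n$ is the symmetric group on $n$ letters. For $\nu\in S_n$ let $F(\nu)$ be its number of fixed points; the metric is $d_S(\sigma,\theta)=n-F(\sigma\theta^{-1})$. For $j\in\{0,\dots,n\}$ let $v_j$ be the number of permutations with exactly $n-j$ fixed points. For nonempty $D\subseteq S_n$, its frequencies are $f_i=|\{(x,y)\in D^2: d_S(x,y)=i\}|/|D|^2$, $i=0,\dots,n$. $D$ is a $t$-design if $\sum_{j=0}^n f_j j^i=\sum_{j=0}^n \frac{v_j}{n!} j^i$ for every $i=1,\dots,t$. *)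

(* Defs.v *)
From mathcomp Require Import all_boot all_order all_algebra all_fingroup.

Set Implicit Arguments.
Unset Strict Implicit.
Unset Printing Implicit Defensive.

Import GRing.Theory.
Local Open Scope ring_scope.

Definition fixpts (n : nat) (s : 'S_n) : nat := #|[set i : 'I_n | s i == i]|.

(* The truncated subtraction is exact since [fixpts s <= n]. MathComp composes
   permutations from left to right; this does not affect the value, as
   [s * t^-1] and [t^-1 * s] are conjugate. *)
Definition dS (n : nat) (s t : 'S_n) : nat := (n - fixpts (s * t^-1)%g)%N.

(* Meant for [j <= n] only. *)
Definition valency (n j : nat) : nat :=
  #|[set s : 'S_n | fixpts s == (n - j)%N]|.

Definition freq (n : nat) (D : {set 'S_n}) (i : nat) : rat :=
  #|[set p : 'S_n * 'S_n | [&& p.1 \in D, p.2 \in D & dS p.1 p.2 == i]]|%:R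
  / (#|D| ^ 2)%:R.

Definition is_design (n : nat) (t : nat) (D : {set 'S_n}) : Prop :=
  forall i : nat, (1 <= i <= t)%N ->
    \sum_(0 <= j < n.+1) freq D j * j%:R ^+ i
    = \sum_(0 <= j < n.+1) ((valency n j)%:R / n`!%:R) * j%:R ^+ i :> rat.

(* Main.v *)
Require Import Defs.
From mathcomp Require Import all_boot all_order all_algebra all_fingroup.
Import GRing.Theory.
Local Open Scope ring_scope.

                                                                           
                                                                             
                                                                               
                                                                   
                                                                             
                       

(** For t = 1 the design condition is a single equation: the mean distance in D equals the mean of n
    - F over the whole group. Double counting shows that a permutation has one fixed point on
    average ([sum_fixpts]), so the latter mean is n - 1 ([mean_valency]), and the criterion
    [design1E] follows. If D has n elements pairwise at distance n, only the distances 0 and n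
    occur; the n(n - 1) off-diagonal pairs out of n^2 give f_n = (n - 1)/n, so the mean distance is
    n f_n = n - 1. *)

Lemma sum_card_fibers (T : finType) (f : T -> nat) (n : nat) :
  (forall x, f x <= n)%N ->
  (\sum_(0 <= j < n.+1) #|[set x | f x == j]| * j = \sum_x f x)%N.
Proof.
move=> fn; rewrite big_mkord.
(* The bound on [f] makes [inord (f x)] a faithful copy of [f x], so the classes are the fibres of
   [f]. *)
rewrite [RHS](partition_big (fun x => inord (f x) : 'I_n.+1) predT) //=.
apply: eq_bigr => j _; rewrite -sum_nat_const.
by apply: eq_big => [x|x]; rewrite inE -?val_eqE /= ?inordK ?ltnS // => /eqP.
Qed.

(** Right multiplication by the transposition of i and j, which acts after s, maps the stabiliser of
    i bijectively onto this set. *)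
Lemma card_perm_fixing (n : nat) (i j : 'I_n) :
  #|[set s : 'S_n | s i == j]| = #|[set s : 'S_n | s i == i]|.
Proof.
rewrite -[RHS](card_imset _ (mulIg (tperm i j))); apply: eq_card => s.
rewrite inE; apply/eqP/imsetP => [sij|[u]].
  exists (s * tperm i j)%g; last by rewrite -mulgA tperm2 mulg1.
  by rewrite inE permM sij tpermR.
by rewrite inE => /eqP ui ->; rewrite permM ui tpermL.
Qed.

(** Count the pairs (s, i) with s i = i by points: the n possible values of s i are taken equally
    often, so each point is fixed by n!/n permutations. *)
Lemma sum_fixpts (n : nat) : (1 <= n)%N ->
  (\sum_(s : 'S_n) fixpts s = n`!)%N.
Proof.
move=> n_gt0.
have card_fix (i : 'I_n) : (n * #|[set s : 'S_n | s i == i]| = n`!)%N.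
  rewrite -card_Sn -[RHS]sum1_card (partition_big (fun s : 'S_n => s i) predT) //=.
  under [RHS]eq_bigr do rewrite sum1dep_card card_perm_fixing.
  by rewrite sum_nat_const card_ord.
transitivity (\sum_(i < n) #|[set s : 'S_n | s i == i]|)%N.
  under eq_bigr do rewrite /fixpts -sum1dep_card big_mkcond.
  rewrite exchange_big; apply: eq_bigr => i _.
  by rewrite -big_mkcond sum1dep_card.
(* Multiplying both sides by n avoids the division n!/n. *)
apply/eqP; rewrite -(eqn_pmul2l n_gt0) big_distrr /=.
by rewrite (eq_bigr (fun=> n`!) (fun i _ => card_fix i)) sum_nat_const card_ord.
Qed.

Lemma dS_id (n : nat) (s : 'S_n) : dS s s = 0%N.
Proof.
rewrite /dS mulgV /fixpts.
have -> : [set i : 'I_n | (1%g : 'S_n) i == i] = [set: 'I_n].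
  by apply/setP => i; rewrite !inE perm1 eqxx.
by rewrite cardsT card_ord subnn.
Qed.

Lemma fixpts_le (n : nat) (s : 'S_n) : (fixpts s <= n)%N.
Proof. by rewrite -[leqRHS]card_ord max_card. Qed.

Lemma sum_valency (n : nat) : (1 <= n)%N ->
  (\sum_(0 <= j < n.+1) valency n j * j = n`! * (n - 1))%N.
Proof.
move=> n_gt0.
transitivity (\sum_(s : 'S_n) (n - fixpts s))%N.
  rewrite -(@sum_card_fibers _ _ n) => [|s]; last exact: leq_subr.
  apply: eq_big_nat => j /andP[_ le_jn]; congr (_ * _)%N.
  apply: eq_card => s; rewrite !inE.
  (* Truncation is harmless: both j and [fixpts s] are at most n, where subtraction from n is an
     involution. *)
  apply/eqP/eqP => [->|<-]; rewrite subKn //; exact: fixpts_le.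
rewrite sumnB => [|s _]; last exact: fixpts_le.
by rewrite sum_fixpts // sum_nat_const card_Sn mulnBr muln1.
Qed.

Lemma mean_valency (n : nat) : (1 <= n)%N ->
  \sum_(0 <= j < n.+1) ((valency n j)%:R / n`!%:R) * j%:R ^+ 1
  = n%:R - 1 :> rat.
Proof.
move=> n_gt0.
have fact_neq0 : n`!%:R != 0 :> rat by rewrite Num.Theory.pnatr_eq0 -lt0n fact_gt0.
transitivity ((\sum_(0 <= j < n.+1) valency n j * j)%N%:R / n`!%:R : rat).
  rewrite natr_sum mulr_suml; apply: eq_bigr => j _.
  by rewrite expr1 natrM mulrAC.
by rewrite sum_valency // natrM mulrAC divff // mul1r natrB.
Qed.

Lemma design1E (n : nat) (D : {set 'S_n}) : (1 <= n)%N ->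
  is_design 1 D <-> \sum_(0 <= j < n.+1) j%:R * freq D j = n%:R - 1 :> rat.
Proof.
move=> n_gt0.
have -> : \sum_(0 <= j < n.+1) j%:R * freq D j
        = \sum_(0 <= j < n.+1) freq D j * j%:R ^+ 1 :> rat.
  by apply: eq_bigr => j _; rewrite expr1 mulrC.
split=> [/(_ 1%N isT)|mean_D i]; first by rewrite mean_valency.
by rewrite -eqn_leq => /eqP <-; rewrite mean_valency.
Qed.

Section Equidistant.

Variables (n : nat) (D : {set 'S_n}).
Hypothesis n_gt0 : (1 <= n)%N.
Hypothesis cardD : #|D| = n.
Hypothesis dist_D : forall x y, x \in D -> y \in D -> x != y -> dS x y = n.

Lemma freq_equidistant_mid (i : nat) : (1 <= i <= n - 1)%N -> freq D i = 0.
Proof.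
move=> /andP[i_gt0 le_in]; rewrite /freq [X in #|pred_of_set X|](_ : _ = set0).
  by rewrite cards0 mul0r.
apply/setP => -[x y]; rewrite !inE /=; apply/negP => /and3P[Dx Dy /eqP dxy].
have [xy|/(dist_D _ _ Dx Dy) dn] := eqVneq x y.
  by rewrite -dxy xy dS_id in i_gt0.
by rewrite -dxy dn subn1 leqNgt ltn_predL n_gt0 in le_in.
Qed.

(** The pairs at distance n are exactly those of D x D off the diagonal, since diagonal pairs have
    distance 0 < n. *)
Lemma freq_equidistant_max : freq D n = (n%:R - 1) / n%:R.
Proof.
have n_neq0 : n%:R != 0 :> rat by rewrite Num.Theory.pnatr_eq0 -lt0n.
rewrite /freq cardD.
have -> : #|[set p : 'S_n * 'S_n | [&& p.1 \in D, p.2 \in D & dS p.1 p.2 == n]]|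
        = (n * (n - 1))%N.
  pose diag := [set (x, x) | x in D].
  have diagD : diag \subset setX D D.
    by apply/subsetP => _ /imsetP[x Dx ->]; rewrite inE /= Dx.
  transitivity #|setX D D :\: diag|.
    apply: eq_card => -[x y]; rewrite !inE /= andbC -andbA.
    have [Dx|] := boolP (x \in D); last by rewrite !andbF.
    have [Dy|] := boolP (y \in D); last by rewrite !andbF.
    rewrite /= !andbT; apply/eqP/negP => [dxy /imsetP[z _ [xz yz]]|ndiag].
      by move: n_gt0; rewrite -dxy xz yz dS_id.
    apply: dist_D => //; apply: contra_not_neq ndiag => xy.
    by apply/imsetP; exists x; rewrite -?xy.
  rewrite cardsD (setIidPr diagD) cardsX card_imset ?cardD ?mulnBr ?muln1 //.
  by move=> x y [].
by rewrite natrM natrB // natrX expr2 -mulf_div divff // mul1r.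
Qed.

Lemma equidistant_design1 : is_design 1 D.
Proof.
have n_neq0 : n%:R != 0 :> rat by rewrite Num.Theory.pnatr_eq0 -lt0n.
(* Only the term j = n survives: the middle frequencies vanish, and f_0 is multiplied by 0. *)
apply/design1E => //; rewrite big_nat_recr //= big1_seq => [|j].
  by rewrite add0r freq_equidistant_max mulrC divfK.
rewrite mem_index_iota => /andP[_ /andP[_ lt_jn]].
case: j lt_jn => [|j] lt_jn; first by rewrite mul0r.
by rewrite freq_equidistant_mid ?mulr0 //= -ltnS subn1 prednK.
Qed.

End Equidistant.

Theorem theorem3 (n : nat) (hn : (1 <= n)%N) (D : {set 'S_n})
    (hD : D != set0) :
  (is_design 1 D <->
     \sum_(0 <= j < n.+1) j%:R * freq D j = n%:R - 1 :> rat)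
  /\
  (#|D| = n ->
   (forall x y : 'S_n, x \in D -> y \in D -> x != y -> dS x y = n) ->
   [/\ forall i : nat, (1 <= i <= n - 1)%N -> freq D i = 0,
       freq D n = (n%:R - 1) / n%:R
     & is_design 1 D]).
Proof.
split=> [|cardD dist_D]; first exact: design1E.
split; [exact: freq_equidistant_mid|exact: freq_equidistant_max|].
exact: equidistant_design1.
Qed.
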